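(* Let $X$ be a separable metric space, and let $X^{\sharp}$ be the closed, dense-in-itself subset of $X$ with $X\setminus X^{\sharp}$ at most countable that is given by the Cantor-Bendixson theorem. There exists a proper dyadic subbase $\mathcal{S}$ of $X$ consisting of half-clopen sets in $X$ such that $\{S\cap X^{\sharp}: S\in\mathcal{S}\}$ is an independent subbase of $X^{\sharp}$ when $X^{\sharp}\neq\emptyset$.
   Context: For a separable metric space $X$, the Cantor-Bendixson theorem gives a perfect (that is, dense in itself) closed set $X^{\sharp}$ in $X$ such that $X\setminus X^{\sharp}$ is at most countable; $X^{\sharp}$ denotes this set, which may be empty. A set is dense in itself if it has no isolated points in its subspace topology. A subset $G$ of a space is regular open if $G$ equals the interior of its closure. The exterior of $G$ is the complement of its closure. A subset $G$ of $X$ is a half-clopen set in $X$ if $G$ is regular open in $X$ and its boundary satisfies $\mathrm{bd}_X G\subseteq X^{\sharp}$. A dyadic subbase of a space $Y$ is a subbase $\mathcal{S}=\{S_{n,i}: n<\omega,\ i<2\}$ of $Y$, indexed by $\omega\times 2$, which is composed of regular open sets and such that $S_{n,1}$ is the exterior of $S_{n,0}$ for each $n<\omega$. Let $\mathbb{T}=\{0,1,\bot\}$; for $\sigma\in\mathbb{T}^{\omega}$ let $\mathrm{dom}(\sigma)=\{n:\sigma(n)\in\{0,1\}\}$, and let $\mathbb{T}^{*}=\{\sigma\in\mathbb{T}^{\omega}: |\mathrm{dom}(\sigma)|<\infty\}$. For a dyadic subbase $\mathcal{S}=\{S_{n,i}: n<\omega,\ i<2\}$ of $Y$ and $\sigma\in\mathbb{T}^{\omega}$,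 let $S(\sigma)=\bigcap_{k\in\mathrm{dom}(\sigma)}S_{k,\sigma(k)}$ and $\bar{S}(\sigma)=\bigcap_{k\in\mathrm{dom}(\sigma)}\mathrm{cl}\,S_{k,\sigma(k)}$ (closures taken in $Y$). The dyadic subbase $\mathcal{S}$ is proper if $\mathrm{cl}\,S(\sigma)=\bar{S}(\sigma)$ for every $\sigma\in\mathbb{T}^{*}$. An independent subbase of $Y$ is a dyadic subbase of $Y$ such that $S(\sigma)$ is not empty for every $\sigma\in\mathbb{T}^{*}$.
   Formalization: Independence of the trace on X♯ is claimed only after omitting the pairs (S_{n,0}, S_{n,1}) having a nonempty member disjoint from X♯; with all pairs kept it fails whenever ∅ ≠ X♯ ≠ X, as some nonempty S(σ) misses X♯. *)

(* Defs.v *)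
From HB Require Import structures.
From mathcomp Require Import all_boot all_order all_algebra.
From mathcomp Require Import all_classical all_reals all_analysis.

Set Implicit Arguments.
Unset Strict Implicit.
Unset Printing Implicit Defensive.

Local Open Scope classical_set_scope.

Definition separable_space (X : topologicalType) :=
  exists2 D : set X, countable D & dense D.

(* The properties of the set given by the Cantor-Bendixson theorem.  They need
   not determine it: set0 and setT both qualify in the space of rationals. *)
Definition cantor_bendixson_set (X : topologicalType) (P : set X) :=
  [/\ closed P, isolated P = set0 & countable (~` P)].

Definition exterior (X : topologicalType) (G : set X) := ~` closure G.

Definition boundary (X : topologicalType) (G : set X) :=
  closure G `\` interior G.

Definition half_clopen (X : topologicalType) (P : set X) (G : set X) :=
  regopen G /\ boundary G `<=` P.

Section dyadic.
Variable Y : topologicalType.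

(* [S n false] and [S n true] are the members of index (n, 0) and (n, 1);
   [sigma n = None] encodes the value bottom. *)
Implicit Types (S : nat -> bool -> set Y) (sigma : nat -> option bool).

Definition tdom sigma := [set n | sigma n <> None].

Definition meetS S sigma :=
  \bigcap_(p in [set p : nat * bool | sigma p.1 = Some p.2]) S p.1 p.2.

Definition meetcl S sigma :=
  \bigcap_(p in [set p : nat * bool | sigma p.1 = Some p.2]) closure (S p.1 p.2).

(* The empty intersection counts as a finite intersection in [finI_from];
   openness of the members of S is part of [basis]. *)
Definition dyadic_subbase S :=
  [/\ basis (finI_from [set: nat * bool] (fun p => S p.1 p.2)),
      forall n i, regopen (S n i) &
      forall n, S n true = exterior (S n false)].

Definition proper_dyadic S :=
  forall sigma, finite_set (tdom sigma) ->
    closure (meetS S sigma) = meetcl S sigma.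

Definition independent_subbase S :=
  dyadic_subbase S /\
  forall sigma, finite_set (tdom sigma) -> meetS S sigma !=set0.

End dyadic.

(* [set_val] is the inclusion of the subspace P, carried by the type
   [set_type P] with the initial topology, so this is S n i intersected with P
   and regarded as a subset of the space P. *)
Definition subbase_trace (X : topologicalType) (P : set X) (S : nat -> bool -> set X)
  (n : nat) (i : bool) : set P := set_val @^-1` S n i.
Arguments subbase_trace {X} P S n i.

(* The indices n for which neither member of the pair (S n false, S n true) is
   a nonempty set missing P.  If P is closed and P <> setT, a subbase of X has
   some S(sigma), with sigma of finite domain, that is nonempty and misses P, so
   the traces of all the pairs are never independent; only pairs with a
   nonempty member missing P are left out, and none is when P = setT. *)
Definition trace_index (X : topologicalType) (P : set X)
  (S : nat -> bool -> set X) : set nat :=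
  [set n | ~ exists i, S n i !=set0 /\ S n i `<=` ~` P].

(* Main.v *)
Require Import Defs.
From mathcomp Require Import all_boot all_order all_algebra.
From mathcomp Require Import all_classical all_reals all_analysis.
From mathcomp Require Import finmap lra.
Import Order.TTheory GRing.Theory Num.Theory.
Import numFieldNormedType.Exports.

(** Let P be the perfect part. The subbase consists of two kinds of pairs.

    The pairs of the first kind are the sets where a continuous real function
    [u n] is negative and where it is positive. The functions are chosen by
    recursion, each being a perturbed distance to a point minus a level that
    avoids countably many values. For a generic level ([generic_level]), a zero
    of [u n] that is a limit of a cell, that is of a set of points of P where
    the earlier functions have prescribed signs, is a limit of points of either
    sign of [u n] in this cell. By induction each point of P is a limit of all
    the cells whose signs do not contradict its own ([cells_dense]). This single
    property yields the regular openness and the exterior relation, in X and in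
    P, and the properness. A generic level also avoids the values taken on the
    countable complement of P, so the boundaries lie in P.

    Independence asks that each function takes both signs on every earlier cell.
    The distance to x is therefore perturbed in the cells that lie entirely in
    the ball of radius 2r or entirely outside the ball of radius r, where it
    might fail to cross a level between r and 2r ([next_function]). This does
    not spoil the separation of p in B(x, r) from points outside B(x, 2r): if p
    is in a cell contained in B(x, 2r), the earlier functions already separate;
    otherwise the distance is not perturbed at p, and the perturbed cells
    outside B(x, r) do not meet the intersection of the earlier members that
    contain p, since p would be a limit of them. With B(x, r) running through a
    countable base, the functions give a subbase on P.

    To pass from P to X, all functions are composed with a continuous retraction
    of X onto P ([exists_retraction]). The pairs of the second kind are a clopen
    set missing P and its complement: a countable base at the points outside P
    ([clopen_base_off]), and clopen sets outside of which the retraction moves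
    points by little ([clopen_far]). Being clopen, they do not affect
    properness, and, being nonempty, they are exactly the pairs to be left out
    of the trace on P. If P is empty, these pairs alone form the subbase. *)

Set Implicit Arguments.
Unset Strict Implicit.
Unset Printing Implicit Defensive.

Local Open Scope classical_set_scope.
Local Open Scope ring_scope.

(** * Countable sets and recursion *)

Lemma countable_enumeration (T : Type) (A : set T) (a : T) :
  A a -> countable A ->
  exists s : nat -> T, (forall n, A (s n)) /\ forall x, A x -> exists n, s n = x.
Proof.
move=> Aa /countable_injP[f finj].
have sP n : exists y, A y /\ ((exists2 x, A x & f x = n) -> f y = n).
  have [[x Ax fx]|nx] := pselect (exists2 x, A x & f x = n).
    by exists x; split.
  by exists a; split.
have [s sE] := choice sP.
exists s; split=> [n|x Ax]; first by have [] := sE n.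
exists (f x); have [As fs] := sE (f x).
by apply: finj; [exact/mem_set|exact/mem_set|apply: fs; exists x].
Qed.

Lemma countable_at_most_one (T : Type) (A : set T) :
  (forall x y, A x -> A y -> x = y) -> countable A.
Proof.
move=> A1; have [[a Aa]|/forallNP A0] := pselect (exists a, A a).
  by rewrite (_ : A = [set a])//; apply/seteqP; split=> [y Ay|y ->//]; exact: A1.
by rewrite (_ : A = set0)// -subset0.
Qed.

(** A countable set of reals misses a point of every nondegenerate interval:
    this is what makes generic levels and radii available. *)
Lemma avoid_countable (R : realType) (a b : R) (C : set R) :
  a < b -> countable C -> exists c, [/\ a < c, c < b & ~ C c].
Proof.
move=> ab cC; apply: contrapT => nc.
have abC : [set` `]a, b[] `<=` C.
  move=> c /=; rewrite in_itv/= => /andP[ac cb].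
  by apply: contrapT => nCc; apply: nc; exists c.
have := countable_lebesgue_measure0 (sub_countable (subset_card_le abC) cC).
rewrite lebesgue_measure_itv/= lte_fin ab => /eqP.
by rewrite -EFinB eqe subr_eq0 gt_eqF.
Qed.

Lemma infinite_enumeration (T : countType) (G : set T) :
  infinite_set G ->
  exists g : nat -> T, [/\ injective g, forall n, G (g n) &
    forall t, G t -> exists n, g n = t].
Proof.
move=> iG.
have /card_set_bijP[f [_ finj fsurj]] := eq_card_nat (countableP G) iG.
have /choice[g gE] : forall n, exists t, G t /\ f t = n.
  by move=> n; have [t Gt ft] := fsurj n I; exists t.
exists g; split=> [n n' gn|n|t Gt].
- by rewrite -(gE n).2 gn (gE n').2.
- exact: (gE n).1.
- exists (f t); apply: finj; [exact/mem_set/(gE _).1|exact/mem_set|].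
  exact: (gE _).2.
Qed.

Lemma finite_set_nat_bounded (A : set nat) :
  finite_set A -> exists N, forall n, A n -> (n < N)%N.
Proof.
move=> /finite_seqP[s ->]; exists (\max_(n <- s) n).+1 => n /= ns.
by rewrite ltnS; exact: (leq_bigmax_seq n ns).
Qed.

(** Choice of a sequence each of whose terms depends on all the earlier ones.
    The relation [Q n u v] takes the earlier terms as a total sequence [u], of
    which it may use the first [n] terms only. *)
Lemma dependent_choice_history (T : Type) (t0 : T)
    (Q : nat -> (nat -> T) -> T -> Prop) :
  (forall n u, exists v, Q n u v) ->
  (forall n u u' v, (forall k, (k < n)%N -> u k = u' k) -> Q n u v -> Q n u' v) ->
  exists u : nat -> T, forall n, Q n u (u n).
Proof.
move=> Qex Qext.
have [next nextP] := choice (fun nu : nat * (nat -> T) => Qex nu.1 nu.2).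
pose fix build n : nat -> T :=
  if n is m.+1 then
    fun k => if (k < m)%N then build m k else next (m, build m)
  else fun=> t0.
have stable n k : (k < n)%N -> build n k = build k.+1 k.
  elim: n => // n IH; rewrite ltnS leq_eqVlt => /predU1P[-> //|kn].
  by rewrite [LHS]/= kn IH.
exists (fun n => build n.+1 n) => n; rewrite [X in Q _ _ X]/= ltnn.
by apply: Qext (nextP (n, build n)) => k; exact: stable.
Qed.

(** * Dyadic subbases from local conditions *)

Lemma nbhs_forall_lt (T : topologicalType) (x : T) (A : nat -> set T) n :
  (forall k, (k < n)%N -> nbhs x (A k)) ->
  nbhs x [set y | forall k, (k < n)%N -> A k y].
Proof.
elim: n => [_|n IH nA]; first by apply: filterS (@filterT _ _ _).
have An : nbhs x (A n) by exact: nA.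
have /IH An' : forall k, (k < n)%N -> nbhs x (A k) by move=> k kn; exact/nA/ltnW.
apply: filterS (filterI An An') => y [yn yn'] k.
by rewrite ltnS leq_eqVlt => /predU1P[->//|]; exact: yn'.
Qed.

(** Two sets each of which has the complement of the other as closure are
    regular open and exteriors of each other, and the points outside both form
    their common boundary. *)
Lemma exterior_complement (Y : topologicalType) (G H : set Y) :
  closure G = ~` H -> closure H = ~` G ->
  [/\ regopen G, H = exterior G & boundary G `<=` ~` (G `|` H)].
Proof.
move=> cG cH; have rG : regopen G by rewrite /regopen cG interiorC cH setCK.
have oG : open G by rewrite -rG; exact: open_interior.
split=> //; first by rewrite /exterior cG setCK.
by move=> y []; rewrite cG (interior_id _).1// => nHy nGy [|].
Qed.

Lemma closure_pair (Y : topologicalType) (S : bool -> set Y) :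
  (forall i, open (S i)) -> (forall y, S false y -> ~ S true y) ->
  (forall i y, ~ S false y -> ~ S true y -> closure (S i) y) ->
  forall i, closure (S i) = ~` S (~~ i).
Proof.
move=> oS dS bS i; apply/seteqP; split=> y.
  have cN : closed (~` S (~~ i)) by rewrite closedC.
  rewrite [X in _ -> X _]((closure_id _).1 cN); apply: closureS => z Sz.
  by case: i Sz {cN} => /= ? ?; apply: (dS z).
move=> nS; have [Sy|nSy] := pselect (S i y); first exact: subset_closure.
by case: i nS nSy => /= ? ?; apply: bS.
Qed.

Lemma basis_finI (Y : topologicalType) (S : nat -> bool -> set Y) :
  (forall n i, open (S n i)) ->
  (forall y U, nbhs y U -> exists F : seq (nat * bool),
     (forall p, p \in F -> S p.1 p.2 y) /\
     (forall z, (forall p, p \in F -> S p.1 p.2 z) -> U z)) ->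
  basis (finI_from [set: nat * bool] (fun p => S p.1 p.2)).
Proof.
move=> oS bS; split=> [_ [D _ <-]|y U /bS[F [Fy FU]]].
  rewrite -closedC setC_bigcap; apply: closed_bigcup => // p _.
  by rewrite closedC; exact: oS.
exists (\bigcap_(p in [set` [fset p | p in F]%fset]) S p.1 p.2).
  split; first by exists [fset p | p in F]%fset => // p _; exact: in_setT.
  by move=> p /=; rewrite inE; exact: Fy.
by move=> z Dz; apply: FU => p pF; apply: Dz; rewrite /= inE.
Qed.

Lemma dyadic_subbase_local (Y : topologicalType) (S : nat -> bool -> set Y) :
  (forall n i, open (S n i)) ->
  (forall n y, S n false y -> ~ S n true y) ->
  (forall n i y, ~ S n false y -> ~ S n true y -> closure (S n i) y) ->
  (forall y U, nbhs y U -> exists F : seq (nat * bool),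
     (forall p, p \in F -> S p.1 p.2 y) /\
     (forall z, (forall p, p \in F -> S p.1 p.2 z) -> U z)) ->
  dyadic_subbase S.
Proof.
move=> oS dS bS fS.
have cS n i : closure (S n i) = ~` S n (~~ i).
  exact: closure_pair (oS n) (dS n) (bS n) i.
split; first exact: basis_finI.
  move=> n i; have := cS n (~~ i); rewrite negbK => cSN.
  by have [] := exterior_complement (cS n i) cSN.
by move=> n; have [] := exterior_complement (cS n false) (cS n true).
Qed.

Lemma closure_meetS (Y : topologicalType) (S : nat -> bool -> set Y) sigma :
  closure (meetS S sigma) `<=` meetcl S sigma.
Proof.
move=> y cly [n i] /= sn; apply: closureS cly => z Sz; exact: Sz (n, i) sn.
Qed.

Lemma half_clopen_local (X : topologicalType) (P : set X)
    (S : nat -> bool -> set X) :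
  (forall n i, open (S n i)) ->
  (forall n y, S n false y -> ~ S n true y) ->
  (forall n y, ~ S n false y -> ~ S n true y ->
     P y /\ forall i, closure (S n i) y) ->
  forall n i, half_clopen P (S n i).
Proof.
move=> oS dS bS n i.
have cS j : closure (S n j) = ~` S n (~~ j).
  apply: closure_pair (oS n) (dS n) _ j => j y n0 n1.
  by have [_] := bS n y n0 n1.
have := cS (~~ i); rewrite negbK => cSN.
have [rS _ bdS] := exterior_complement (cS i) cSN.
split=> // y /bdS /not_orP[]; case: i {cSN rS bdS} => /= n0 n1.
  by have [] := bS n y n1 n0.
by have [] := bS n y n0 n1.
Qed.

(** Properness has to be checked only at the points of [P]: a point outside
    [P] lies in no boundary, so it belongs to each member of the subbase whose
    closure contains it. *)
Lemma proper_dyadic_off_boundary (X : topologicalType) (P : set X)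
    (S : nat -> bool -> set X) :
  (forall n i, open (S n i)) ->
  (forall n y, S n false y -> ~ S n true y) ->
  (forall n y, ~ S n false y -> ~ S n true y ->
     P y /\ forall i, closure (S n i) y) ->
  (forall sigma p, finite_set (tdom sigma) -> P p -> 
    (forall n i, sigma n = Some i -> ~ S n (~~ i) p) ->
    closure (meetS S sigma) p) ->
  proper_dyadic S.
Proof.
move=> oS dS bS lS sigma fs; apply/seteqP; split; first exact: closure_meetS.
have cS n j : closure (S n j) = ~` S n (~~ j).
  apply: closure_pair (oS n) (dS n) _ j => i y n0 n1.
  by have [_] := bS n y n0 n1.
move=> p clp.
have np n i : sigma n = Some i -> ~ S n (~~ i) p.
  by move=> sn; have := clp (n, i) sn; rewrite /= cS.
have [Pp|nPp] := pselect (P p); first exact: lS.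
apply: subset_closure => -[n i] /= sn; apply: contrapT => nS; apply: nPp.
have := np n i sn; case: i sn nS => /= sn n1 n0.
  by have [] := bS n p n0 n1.
by have [] := bS n p n1 n0.
Qed.

(** * Metric neighbourhoods and tent functions *)

Lemma nbhs_mdist (R : realType) (X : metricType R) (x : X) (A : set X) :
  nbhs x A <-> exists2 e : R, 0 < e & forall y, mdist x y < e -> A y.
Proof.
rewrite -metricType_numDomainType.nbhs_nbhs_mdist; split=> -[e e0 eA].
  by exists e => // y xy; exact: eA.
by exists e => // y xy; exact: eA.
Qed.

Lemma closure_mdist (R : realType) (X : metricType R) (x : X) (A : set X) :
  closure A x <-> forall e : R, 0 < e -> exists2 y, A y & mdist x y < e.
Proof.
split=> [cA e e0|cA B /nbhs_mdist[e e0 eB]].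
  have /cA[y [Ay xy]] : nbhs x [set y | mdist x y < e].
    by apply/nbhs_mdist; exists e.
  by exists y.
by have [y Ay /eB By] := cA e e0; exists y.
Qed.

Lemma mdist_continuous (R : realType) (X : metricType R) (x : X) :
  continuous (mdist x : X -> R).
Proof.
move=> y; apply/cvgrPdist_lt => e e0; apply/nbhs_mdist; exists e => // z yz.
have h1 := metric_triangle x y z.
have h2 := metric_triangle x z y.
by rewrite (metric_sym z y) in h2; rewrite ltr_norml; apply/andP; split; lra.
Qed.

(** The function with value 1 at [c] that decreases linearly in the distance to
    [c] and vanishes at distance [d] and beyond. *)
Definition tent (R : realType) (X : metricType R) (c : X) (d : R) (x : X) : R :=
  Num.max 0 (1 - mdist c x / d).

Lemma tent_continuous (R : realType) (X : metricType R) (c : X) (d : R) :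
  continuous (tent c d).
Proof.
move=> x; apply: (@continuous_max R X (cst 0) (fun y => 1 - mdist c y / d) x).
  exact: cst_continuous.
apply: continuousB; first exact: cst_continuous.
by apply: continuousM; [exact: mdist_continuous|exact: cst_continuous].
Qed.

Lemma tent_center (R : realType) (X : metricType R) (c : X) (d : R) :
  tent c d c = 1.
Proof. by rewrite /tent mdistxx mul0r subr0; apply/max_idPr. Qed.

Lemma tent_out (R : realType) (X : metricType R) (c : X) (d : R) x :
  0 < d -> d <= mdist c x -> tent c d x = 0.
Proof.
by move=> d0 dx; apply/max_idPl; rewrite subr_le0 ler_pdivlMr// mul1r.
Qed.

(** * Cells cut out by a sequence of functions *)

(** [side true v] and [side false v] say that [v] is positive, respectively
    negative.  A continuous function [u n] gives the pair of disjoint open sets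
    where [u n] has side [false] and where it has side [true]. *)
Definition side (R : realType) (i : bool) (v : R) : Prop :=
  if i then 0 < v else v < 0.

Lemma open_side (R : realType) (X : metricType R) (v : X -> R) i :
  continuous v -> open [set x | side i (v x)].
Proof.
move=> cv; case: i => /=.
  by move/continuousP: cv => /(_ _ (@open_gt R 0)).
by move/continuousP: cv => /(_ _ (@open_lt R 0)).
Qed.

Lemma side_neq (R : realType) (v : R) : v != 0 -> side (0 < v) v.
Proof. by rewrite /side; case: ltgtP. Qed.

Lemma side_disjoint (R : realType) (v : R) : side false v -> ~ side true v.
Proof. by move=> /= v0 /(lt_trans v0); rewrite ltxx. Qed.

Lemma side_eq0 (R : realType) (v : R) : ~ side false v -> ~ side true v -> v = 0.
Proof. by rewrite /side => /negP + /negP; case: ltgtP. Qed.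

(** The cell of level [n] with signs [b]: the first [n] functions of [u] are
    nonzero with the signs [b 0], ..., [b n.-1].  The later values of [b] are
    irrelevant. *)
Definition cell (R : realType) (X : metricType R) (u : nat -> X -> R)
    (n : nat) (b : nat -> bool) : set X :=
  [set x | forall k, (k < n)%N -> side (b k) (u k x)].

Lemma open_cell (R : realType) (X : metricType R) (u : nat -> X -> R) n b :
  (forall k, (k < n)%N -> continuous (u k)) -> open (cell u n b).
Proof.
elim: n => [_|n IH cu].
  by rewrite (_ : cell u 0 b = setT); [exact: openT|apply/seteqP; split].
rewrite (_ : cell u n.+1 b = cell u n b `&` [set x | side (b n) (u n x)]).
  apply: openI; [by apply: IH => k kn; exact/cu/ltnW|exact: open_side (cu n _)].
apply/seteqP; split=> [x xb|x [xb xn] k].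
  by split=> [k kn|]; apply: xb => //; exact: ltnW.
by rewrite ltnS leq_eqVlt => /predU1P[->|/xb].
Qed.

(** Each of the first [n] functions is zero at [p] or has there the sign given
    by [b]. *)
Definition compatible (R : realType) (X : metricType R) (u : nat -> X -> R)
    (n : nat) (b : nat -> bool) (p : X) : Prop :=
  forall k, (k < n)%N -> u k p = 0 \/ side (b k) (u k p).

(** [y] lies in the intersection of those members of the first [n] pairs that
    contain [p]; no condition comes from the functions vanishing at [p]. *)
Definition agree (R : realType) (X : metricType R) (u : nat -> X -> R)
    (n : nat) (p y : X) : Prop :=
  forall k, (k < n)%N -> forall i, side i (u k p) -> side i (u k y).

Lemma cell_ext (R : realType) (X : metricType R) (u u' : nat -> X -> R) n :
  (forall k, (k < n)%N -> u k = u' k) -> cell u n = cell u' n.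
Proof.
move=> uu'; apply/funext => b; apply/seteqP.
by split=> x xb k kn; have := xb k kn; rewrite uu'.
Qed.

Lemma compatible_ext (R : realType) (X : metricType R) (u u' : nat -> X -> R) n :
  (forall k, (k < n)%N -> u k = u' k) -> compatible u n = compatible u' n.
Proof.
move=> uu'; apply/funext => b; apply/funext => p; apply/propext.
by split=> x k kn; have := x k kn; rewrite uu'.
Qed.

Lemma agree_ext (R : realType) (X : metricType R) (u u' : nat -> X -> R) n :
  (forall k, (k < n)%N -> u k = u' k) -> agree u n = agree u' n.
Proof.
move=> uu'; apply/funext => p; apply/funext => y; apply/propext.
by split=> x k kn; have := x k kn; rewrite uu'.
Qed.

Lemma cell_extb (R : realType) (X : metricType R) (u : nat -> X -> R) n b b' :
  (forall k, (k < n)%N -> b k = b' k) -> cell u n b = cell u n b'.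
Proof.
move=> bb'; apply/seteqP.
by split=> x xb k kn; have := xb k kn; rewrite bb'.
Qed.

Lemma cell_bits (R : realType) (X : metricType R) (u : nat -> X -> R) n b x :
  cell u n b x -> forall b', cell u n b' x -> forall k, (k < n)%N -> b k = b' k.
Proof.
move=> xb b' xb' k kn; have := xb k kn; have := xb' k kn; rewrite /side.
by case: (b k); case: (b' k) => // h1 h2; have := lt_trans h1 h2; rewrite ltxx.
Qed.

(** Sign sequences of length [n], as a finite index type for the cells of
    level [n]. *)
Definition bits (n : nat) (t : n.-tuple bool) : nat -> bool := nth false t.

Lemma bits_surj (n : nat) (b : nat -> bool) :
  exists t : n.-tuple bool, forall k, (k < n)%N -> bits t k = b k.
Proof.
exists [tuple of mkseq b n] => k kn; exact: nth_mkseq.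
Qed.

(** Independence of the first [n] pairs on [P]. *)
Definition cells_nonempty (R : realType) (X : metricType R) (P : set X)
    (u : nat -> X -> R) (n : nat) : Prop :=
  forall b, P `&` cell u n b !=set0.

(** Properness of the first [n] pairs in a strong form: a point of [P] is a
    limit of points of [P] in each cell that it is compatible with. *)
Definition cells_dense (R : realType) (X : metricType R) (P : set X)
    (u : nat -> X -> R) (n : nat) : Prop :=
  forall b p, P p -> compatible u n b p -> closure (P `&` cell u n b) p.

(** [v] takes both signs on each cell of level [n] in [P]. *)
Definition splits (R : realType) (X : metricType R) (P : set X)
    (u : nat -> X -> R) (n : nat) (v : X -> R) : Prop :=
  forall b i, P `&` cell u n b `&` [set q | side i (v q)] !=set0.

(** Zero is not a local extremum value of [v] on a cell of level [n] in [P],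
    at points of [P] in the closure of that cell. *)
Definition splits_locally (R : realType) (X : metricType R) (P : set X)
    (u : nat -> X -> R) (n : nat) (v : X -> R) : Prop :=
  forall b i p, P p -> v p = 0 -> closure (P `&` cell u n b) p ->
    closure (P `&` cell u n b `&` [set q | side i (v q)]) p.

(** For [p] in [P] within [r] of [x], the intersection of the members of the
    first [n] pairs that contain [p], and of the set where [v < 0] if it
    contains [p], has all its points of [P] within [2 * r] of [x]. *)
Definition separates (R : realType) (X : metricType R) (P : set X)
    (u : nat -> X -> R) (n : nat) (v : X -> R) (x : X) (r : R) : Prop :=
  forall p y, P p -> P y -> mdist x p < r -> agree u n p y ->
    (v p < 0 -> v y < 0) -> mdist x y < 2 * r.

(** * The inductive step *)

(** No point of [P] is isolated in [P]. *)
Definition dense_in_itself (R : realType) (X : metricType R) (P : set X) :=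
  forall p, P p -> forall e : R, 0 < e ->
  exists q, [/\ P q, q != p & mdist p q < e].

Lemma isolated0_dense_in_itself (R : realType) (X : metricType R) (P : set X) :
  isolated P = set0 -> dense_in_itself P.
Proof.
move=> iP p Pp e e0; apply: contrapT => nq.
suff : isolated P p by rewrite iP.
split; first exact: mem_set.
exists [set q | mdist p q < e]; first by apply/nbhs_mdist; exists e.
apply/seteqP; split=> [q /= [pq Pq]|_ ->]; last by rewrite /= mdistxx.
by apply: contrapT => /eqP qp; apply: nq; exists q.
Qed.

Lemma dense_in_itself_open (R : realType) (X : metricType R) (P C : set X) p :
  dense_in_itself P -> open C -> P p -> C p ->
  exists q, [/\ P q, C q & q != p].
Proof.
move=> dP oC Pp Cp.
have /nbhs_mdist[e e0 eC] : nbhs p C by exact: open_nbhs_nbhs.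
by have [q [Pq qp pq]] := dP p Pp e e0; exists q; split => //; exact: eC.
Qed.

Lemma two_tents (R : realType) (X : metricType R) (C : set X) (p q : X)
    (a b : R) :
  open C -> C p -> C q -> q != p ->
  exists beta : X -> R, [/\ continuous beta, forall y, beta y != 0 -> C y,
    beta p = a & beta q = b].
Proof.
move=> oC Cp Cq qp.
have /nbhs_mdist[e1 e10 e1C] : nbhs p C by exact: open_nbhs_nbhs.
have /nbhs_mdist[e2 e20 e2C] : nbhs q C by exact: open_nbhs_nbhs.
have pq0 : 0 < mdist q p by rewrite mdist_gt0.
pose e := Num.min (Num.min e1 e2) (mdist q p).
have e0 : 0 < e by rewrite !lt_min e10 e20.
have ee1 : e <= e1 by rewrite !ge_min lexx.
have ee2 : e <= e2 by rewrite !ge_min lexx orbT.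
have eqp : e <= mdist q p by rewrite !ge_min lexx !orbT.
exists (fun y => a * tent p e y + b * tent q e y); split.
- by move=> y; apply: cvgD; apply: cvgM;
    [exact: cvg_cst|exact: tent_continuous|exact: cvg_cst|exact: tent_continuous].
- move=> y; apply: contra_neqP => nCy; rewrite !tent_out ?mulr0 ?addr0 //.
    by rewrite leNgt; apply/negP => qy; apply/nCy/e2C/(lt_le_trans qy).
  by rewrite leNgt; apply/negP => py; apply/nCy/e1C/(lt_le_trans py).
- by rewrite tent_center mulr1 tent_out// mulr0 addr0.
- by rewrite tent_center mulr1 tent_out ?mulr0 ?add0r// metric_sym.
Qed.

(** A perturbation [beta], supported in the open set [C], such that the
    perturbed distance to [x] reaches both a value at most [r] and a value at
    least [2 * r] on [P `&` C]. The distance is left alone unless [P `&` C] lies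
    inside the ball of radius [2 * r] or outside the ball of radius [r]; then
    two distinct points of [P `&` C] carry a tent each. *)
Lemma cell_adjustment (R : realType) (X : metricType R) (P C : set X)
    (x : X) (r : R) :
  0 < r -> dense_in_itself P -> open C -> P `&` C !=set0 ->
  exists beta : X -> R,
    [/\ continuous beta, forall y, beta y != 0 -> C y,
        exists y, [/\ P y, C y & mdist x y + beta y <= r],
        exists y, [/\ P y, C y & 2 * r <= mdist x y + beta y] &
        [\/ forall y, beta y = 0,
            forall y, P y -> C y -> mdist x y < 2 * r |
            forall y, P y -> C y -> r <= mdist x y]].
Proof.
move=> r0 dP oC [p [Pp Cp]].
have [q Pq [Cq qp]] : exists2 q, P q & C q /\ q != p.
  by have [q [? ? ?]] := dense_in_itself_open dP oC Pp Cp; exists q.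
have [beta [cbeta Cbeta betap betaq]] :=
  two_tents (2 * r) (- mdist x q) oC Cp Cq qp.
have qr : mdist x q + beta q <= r by rewrite betaq subrr ltW.
have pr : 2 * r <= mdist x p + beta p by rewrite betap lerDr mdist_ge0.
have [[y [Py Cy yr]]|no1] :=
  pselect (exists y, [/\ P y, C y & mdist x y < r]); last first.
  exists beta; split=> //; [by exists q|by exists p|constructor 3 => y Py Cy].
  by rewrite leNgt; apply/negP => yr; apply: no1; exists y.
have [[z [Pz Cz zr]]|no2] :=
  pselect (exists y, [/\ P y, C y & 2 * r <= mdist x y]); last first.
  exists beta; split=> //; [by exists q|by exists p|constructor 2 => z Pz Cz].
  by rewrite ltNge; apply/negP => zr; apply: no2; exists z.
exists (fun=> 0); split.
- exact: cst_continuous.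
- by move=> ?; rewrite eqxx.
- by exists y; rewrite addr0 ltW.
- by exists z; rewrite addr0.
- by constructor 1.
Qed.

(** Every interval contains a level [c] of [f], outside a given countable set,
    that is not a local extremum value of [f] on any of countably many sets
    [W t].  Indeed, for each [t] and each ball of a countable base, at most one
    level is the maximum of [f] on the part of [W t] in that ball and attained
    there in the closure of [W t], and likewise for the minimum. *)
Lemma generic_level (R : realType) (X : metricType R) (I : countType)
    (W : I -> set X) (f : X -> R) (z : nat -> X) (s : nat -> R) (D : set R)
    (a b : R) :
  continuous f -> countable D -> a < b ->
  (forall p (e : R), 0 < e -> exists2 m, mdist (z m) p < s m & 3 * s m < e) ->
  exists c, [/\ a < c, c < b, ~ D c &
    forall t i p, f p = c -> closure (W t) p ->
      closure (W t `&` [set q | side i (f q - c)]) p].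
Proof.
move=> cf cD ab base.
have fc_cont c : continuous (fun q => f q - c).
  by move=> y; apply: cvgB; [exact: cf|exact: cvg_cst].
have openU m : open [set q | mdist (z m) q < s m].
  have /continuousP /(_ _ (@open_lt R (s m))) := @mdist_continuous R X (z m).
  exact.
pose extremal (tmi : I * nat * bool) : set R :=
  let: (t, m, i) := tmi in [set c | exists p,
    [/\ f p = c, closure (W t) p, mdist (z m) p < s m &
        forall q, W t q -> mdist (z m) q < s m -> ~ side i (f q - c)]].
have extremal1 tmi c c' : extremal tmi c -> extremal tmi c' -> c = c'.
  case: tmi => [[t m] i] /= [p [fp clp Up extp]] [p' [fp' clp' Up' extp']].
  have le_level y d d' : f y = d -> closure (W t) y -> mdist (z m) y < s m ->
      (forall q, W t q -> mdist (z m) q < s m -> ~ side i (f q - d')) ->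
      ~ side i (d - d').
    move=> fy cly Uy ext sd.
    have /cly[q [Wq [Uq sq]]] : nbhs y ([set q | mdist (z m) q < s m] `&`
        [set q | side i (f q - d')]).
      apply: open_nbhs_nbhs; split.
        by apply: openI; [exact: openU|exact: open_side].
      by split=> //=; rewrite fy.
    exact: ext Wq Uq sq.
  have := le_level _ _ _ fp clp Up extp'.
  have := le_level _ _ _ fp' clp' Up' extp.
  by rewrite /side; case: i {extp extp' le_level} => /negP + /negP;
    rewrite -!leNgt => h1 h2; lra.
have [c [ac cb Dc]] : exists c, [/\ a < c, c < b &
    ~ (D `|` \bigcup_(tmi in setT) extremal tmi) c].
  apply: avoid_countable => //; rewrite -bigcup2E; apply: bigcup_countable => //.
  case=> [_|[_|i _]] /=; [exact: cD| |exact: countable0].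
  apply: bigcup_countable => // tmi _; apply: countable_at_most_one => ? ?.
  exact: extremal1.
move/not_orP: Dc => [nDc next].
exists c; split=> // t i p fp clp; apply/closure_mdist => e e0.
have [m Um sm] := base p e e0.
apply: contrapT => nq; apply: next; exists (t, m, i) => //=.
exists p; split=> // q Wq Uq sq; apply: nq; exists q => //.
have h1 := metric_triangle p (z m) q.
by rewrite (metric_sym p (z m)) in h1; have h2 := mdist_ge0 (z m) p; lra.
Qed.

(** [rho] is a continuous retraction of the space onto [P]. *)
Definition retraction (X : topologicalType) (P : set X) (rho : X -> X) : Prop :=
  [/\ continuous rho, forall x, P (rho x) & forall x, P x -> rho x = x].

(** The induction step.  Given [n] functions with nonempty cells and the strong
    form of properness, there is one more that keeps both and that separates the
    points of [P] near [x] from those at distance at least [2 * r].  It is the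
    perturbed distance to [x], minus a generic level between [r] and [2 * r],
    composed with the retraction; its zeros avoid the countable complement of
    [P]. *)
Lemma next_function (R : realType) (X : metricType R) (P : set X)
    (rho : X -> X) (z : nat -> X) (s : nat -> R)
    (n : nat) (u : nat -> X -> R) (x : X) (r : R) :
  retraction P rho -> countable (~` P) -> dense_in_itself P ->
  (forall p (e : R), 0 < e -> exists2 m, mdist (z m) p < s m & 3 * s m < e) ->
  (forall k, (k < n)%N -> continuous (u k)) ->
  cells_nonempty P u n -> cells_dense P u n -> 0 < r ->
  exists v : X -> R,
    [/\ continuous v, forall y, v (rho y) = v y & forall y, v y = 0 -> P y] /\
    [/\ splits P u n v, splits_locally P u n v & separates P u n v x r].
Proof.
move=> [crho Prho rhoP] cP dP base cu neP deP r0.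
have /choice[beta betaP] : forall t : n.-tuple bool, exists beta : X -> R,
    [/\ continuous beta, forall y, beta y != 0 -> cell u n (bits t) y,
        exists y, [/\ P y, cell u n (bits t) y & mdist x y + beta y <= r],
        exists y, [/\ P y, cell u n (bits t) y & 2 * r <= mdist x y + beta y] &
        [\/ forall y, beta y = 0,
            forall y, P y -> cell u n (bits t) y -> mdist x y < 2 * r |
            forall y, P y -> cell u n (bits t) y -> r <= mdist x y]].
  by move=> t; apply: cell_adjustment => //; exact: open_cell.
pose f y := mdist x y + \sum_(t : n.-tuple bool) beta t y.
have cf : continuous f.
  move=> y; apply: cvgD; first exact: mdist_continuous.
  apply: continuous_big; first exact: add_continuous.
  by move=> t _; have [] := betaP t.
(* The cells are disjoint, so at most one perturbation is nonzero at y. *)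
have fE t y : cell u n (bits t) y -> f y = mdist x y + beta t y.
  move=> ty; rewrite /f (bigD1 t)//= big1 ?addr0// => t' t't.
  apply: contra_neq_eq t't => bt'y.
  have [_ /(_ _ bt'y) t'y _ _ _] := betaP t'.
  apply/val_inj/(@eq_from_nth _ false); rewrite ?size_tuple// => k kn.
  exact: (cell_bits t'y ty).
have f0 y : (forall t, cell u n (bits t) y -> beta t y = 0) -> f y = mdist x y.
  move=> b0; rewrite /f big1 ?addr0// => t _; apply/eqP; apply: contrapT.
  move=> /negP by0; have [_ /(_ _ by0) /b0 + _ _ _] := betaP t.
  by move/eqP; apply/negP.
have fD y : f y != mdist x y ->
    exists t, cell u n (bits t) y /\ beta t y <> 0.
  move=> fy; apply: contrapT => /forallNP nt; move/eqP: fy; apply; apply: f0.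
  by move=> t ty; apply: contrapT => nb; exact: (nt t).
have r2r : r < 2 * r by lra.
have [c [rc c2r ncP gen]] := generic_level
  (fun t : n.-tuple bool => P `&` cell u n (bits t)) cf
  (sub_countable (card_image_le (f \o rho) (~` P)) cP) r2r base.
exists (fun y => f (rho y) - c); split; split.
- move=> y; apply: cvgB; last exact: cvg_cst.
  by apply: continuous_comp; [exact: crho|exact: cf].
- by move=> y; rewrite (rhoP (rho y))//.
- move=> y /eqP; rewrite subr_eq0 => /eqP fy; apply: contrapT => nPy.
  by apply: ncP; exists y.
- move=> b i; have [t tb] := bits_surj n b.
  rewrite -(cell_extb u tb).
  have [_ _ [y [Py ty yr]] [y' [Py' ty' y'r]] _] := betaP t.
  case: i; [exists y'|exists y]; split=> //=; rewrite rhoP// (fE t)// /side; lra.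
- move=> b i p Pp; rewrite (rhoP p)// => /eqP; rewrite subr_eq0 => /eqP fp.
  have [t tb] := bits_surj n b.
  rewrite -(cell_extb u tb) => /(gen _ i _ fp); apply: closureS => q [[Pq tq]].
  by rewrite /= (rhoP q).
move=> p y Pp Py xp pay; rewrite !rhoP// => vpy.
(* If the cell of p is small, agreeing with p already confines y. *)
have [[t [tp tr]]|nG] :=
  pselect (exists t : n.-tuple bool, cell u n (bits t) p /\
    forall y, P y -> cell u n (bits t) y -> mdist x y < 2 * r).
  by apply: tr => // k kn; exact: (pay k kn _ (tp k kn)).
(* Otherwise the distance is not perturbed at p, because a perturbed cell that
   contains p would be small. *)
have fp : f p = mdist x p.
  apply: f0 => t tp; have [_ _ _ _ [->//|tr|tr]] := betaP t.
    by exfalso; apply: nG; exists t.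
  by have := tr p Pp tp; rewrite leNgt xp.
have fy : f y < c by rewrite -subr_lt0; apply: vpy; rewrite fp; lra.
rewrite ltNge; apply/negP => ry.
(* A far point y with f y < c lies in a perturbed cell outside the ball of
   radius r; but p is compatible with that cell, hence a limit of it. *)
have /fD[t [ty bty]] : f y != mdist x y by apply/negP => /eqP fxy; lra.
have [_ _ _ _ [b0|tr|tr]] := betaP t.
- exact: bty.
- by have := tr y Py ty; rewrite ltNge ry.
have /deP : compatible u n (bits t) p.
  move=> k kn; have [->|up0] := eqVneq (u k p) 0; [by left|right].
  have := pay k kn _ (side_neq up0); have := ty k kn; rewrite /side.
  have := side_neq up0; rewrite /side.
  by case: (bits t k); case: ltgtP => //= ? _ h1 h2; have := lt_trans h1 h2;
    rewrite ltxx.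
move=> /(_ Pp) /closure_mdist /(_ (r - mdist x p)).
rewrite subr_gt0 => /(_ xp)[q [Pq tq] pq].
have := tr q Pq tq; have := metric_triangle x p q; lra.
Qed.

(** * The sequence of functions *)

Lemma cells_nonemptyS (R : realType) (X : metricType R) (P : set X)
    (u : nat -> X -> R) n :
  splits P u n (u n) -> cells_nonempty P u n.+1.
Proof.
move=> su b; have [q [[Pq bq] sq]] := su b (b n).
exists q; split=> // k; rewrite ltnS leq_eqVlt => /predU1P[->//|]; exact: bq.
Qed.

Lemma cells_denseS (R : realType) (X : metricType R) (P : set X)
    (u : nat -> X -> R) n :
  continuous (u n) -> splits_locally P u n (u n) -> cells_dense P u n ->
  cells_dense P u n.+1.
Proof.
move=> cu su du b p Pp bp.
have clp : closure (P `&` cell u n b) p.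
  by apply: du => // k kn; apply: bp; exact: ltnW.
have : closure (P `&` cell u n b `&` [set q | side (b n) (u n q)]) p.
  case: (bp n (ltnSn n)) => [unp|sp]; first exact: su.
  move=> B Bp.
  have /clp[q [[Pq bq] [Bq sq]]] : nbhs p (B `&` [set q | side (b n) (u n q)]).
    apply: filterI => //; apply: open_nbhs_nbhs; split => //.
    exact: open_side.
  by exists q.
apply: closureS => q [[Pq bq] sq]; split => // k.
by rewrite ltnS leq_eqVlt => /predU1P[->//|]; exact: bq.
Qed.

(** The balls of a countable base.  The factor 3 ensures that a point within
    twice the radius of the centre is within [e] of [p]. *)
Lemma ball_sequence (R : realType) (X : metricType R) (x0 : X) :
  separable_space X ->
  exists z : nat -> X, exists s : nat -> R, (forall n, 0 < s n) /\
    forall p (e : R), 0 < e -> exists2 m, mdist (z m) p < s m & 3 * s m < e.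
Proof.
move=> [D cD dD].
have [a0 [_ Da0]] : setT `&` D !=set0 by apply: dD; [exists x0|exact: openT].
have [a [_ aD]] := countable_enumeration Da0 cD.
pose nk (m : nat) : nat * nat := odflt (0, 0)%N (choice.unpickle m).
exists (fun m => a (nk m).1), (fun m => (nk m).2.+1%:R^-1); split=> [n|p e e0].
  by rewrite invr_gt0.
have [k ke] : exists k : nat, 3 / k.+1%:R < e.
  exists (Num.truncn (3 / e)); rewrite ltr_pdivrMr// mulrC -ltr_pdivrMr//.
  exact: truncnS_gt.
have k0 : 0 < k.+1%:R^-1 :> R by rewrite invr_gt0.
have [q [/= pq Dq]] : [set q | mdist p q < k.+1%:R^-1] `&` D !=set0.
  apply: dD; first by exists p; rewrite /= mdistxx.
  by have /continuousP /(_ _ (@open_lt R k.+1%:R^-1)) := @mdist_continuous R X p.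
have [i ai] := aD q Dq.
by exists (choice.pickle (i, k)); rewrite /nk choice.pickleK//= ai metric_sym.
Qed.

Lemma function_sequence (R : realType) (X : metricType R) (P : set X)
    (rho : X -> X) (z : nat -> X) (s : nat -> R) :
  retraction P rho -> countable (~` P) -> dense_in_itself P -> P !=set0 ->
  (forall n, 0 < s n) ->
  (forall p (e : R), 0 < e -> exists2 m, mdist (z m) p < s m & 3 * s m < e) ->
  exists u : nat -> X -> R,
    [/\ forall n, [/\ continuous (u n), forall y, u n (rho y) = u n y &
                      forall y, u n y = 0 -> P y],
        forall n, cells_nonempty P u n,
        forall n, cells_dense P u n &
        forall n, separates P u n (u n) (z n) (s n)].
Proof.
move=> rP cP dP [p0 Pp0] s0 base.
pose Q n u (v : X -> R) :=
  (forall k, (k < n)%N -> continuous (u k)) ->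
  cells_nonempty P u n -> cells_dense P u n ->
  [/\ continuous v, forall y, v (rho y) = v y & forall y, v y = 0 -> P y] /\
  [/\ splits P u n v, splits_locally P u n v & separates P u n v (z n) (s n)].
have [u uQ] : exists u, forall n, Q n u (u n).
  apply: (dependent_choice_history (fun=> 0)) => [n u|n u u' v uu'].
    have [[cu [neu deu]]|nH] := pselect
      ((forall k, (k < n)%N -> continuous (u k)) /\
       cells_nonempty P u n /\ cells_dense P u n).
      have [v vP] := next_function (z n) rP cP dP base cu neu deu (s0 n).
      by exists v.
    by exists (fun=> 0) => cu neu deu; exfalso; apply: nH.
  rewrite /Q /cells_nonempty /cells_dense /splits /splits_locally /separates.
  rewrite (cell_ext uu') (compatible_ext uu') (agree_ext uu') => H cu'.
  by apply: H => k kn; rewrite uu'//; exact: cu'.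
have inv n : (forall k, (k < n)%N -> continuous (u k)) /\
    cells_nonempty P u n /\ cells_dense P u n.
  elim: n => [|n [cu [neu deu]]].
    split=> //; split=> [b|b p Pp _]; first by exists p0.
    by move=> B /nbhs_singleton Bp; exists p.
  have [[cv _ _] [sv lv _]] := uQ n cu neu deu.
  split; last by split; [exact: cells_nonemptyS|exact: cells_denseS].
  by move=> k; rewrite ltnS leq_eqVlt => /predU1P[->//|]; exact: cu.
exists u; split=> n; have [cu [neu deu]] := inv n => //.
  by have [] := uQ n cu neu deu.
by have [_ []] := uQ n cu neu deu.
Qed.

(** * Clopen sets off the perfect part, and the retraction *)

(** Among the balls around [x] that miss [P], those whose radius is not a
    distance from [x] to the countable complement of [P] have an empty sphere.
    *)
Lemma clopen_ball (R : realType) (X : metricType R) (P : set X) (x : X)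
    (a b : R) :
  countable (~` P) -> (forall y, mdist x y < b -> ~ P y) -> a < b ->
  exists r, [/\ a < r, r < b & clopen [set y | mdist x y < r]].
Proof.
move=> cP xP ab.
have [r [ar rb nr]] := avoid_countable ab
  (sub_countable (card_image_le (mdist x) (~` P)) cP).
exists r; split=> //; split.
  by have /continuousP /(_ _ (@open_lt R r)) := @mdist_continuous R X x.
rewrite -openC (_ : ~` _ = [set y | r < mdist x y]).
  by have /continuousP /(_ _ (@open_gt R r)) := @mdist_continuous R X x.
apply/seteqP; split=> y /=; last first.
  by move=> ry yr; have := lt_trans ry yr; rewrite ltxx.
move/negP; rewrite -leNgt le_eqVlt => /predU1P[ry|//].
by exfalso; apply: nr; exists y => //; apply: xP; rewrite -ry.
Qed.

Lemma closed_ball_avoid (R : realType) (X : metricType R) (P : set X) (x : X) :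
  closed P -> ~ P x -> exists2 e : R, 0 < e & forall y, mdist x y < e -> ~ P y.
Proof.
move=> cP nPx; apply/(nbhs_mdist x (~` P))/open_nbhs_nbhs.
by split=> //; rewrite openC.
Qed.

(** A clopen ball around a point outside [P] whose radius is comparable to the
    distance to [P], together with a point of [P] at a comparable distance. *)
Lemma clopen_ball_near (R : realType) (X : metricType R) (P : set X) (x : X) :
  closed P -> countable (~` P) -> P !=set0 -> ~ P x ->
  exists rq : R * X, [/\ 0 < rq.1, clopen [set y | mdist x y < rq.1],
    forall y, mdist x y < 2 * rq.1 -> ~ P y, P rq.2 & mdist x rq.2 < 8 * rq.1].
Proof.
move=> clP cP [p0 Pp0] nPx.
have [e e0 eP] := closed_ball_avoid clP nPx.
pose A : set R := mdist x @` P.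
have lbA : lbound A e.
  move=> _ [y Py <-]; rewrite leNgt; apply/negP => /eP; exact.
have iA : has_inf A by split; [exists (mdist x p0), p0|exists e].
have D0 : 0 < inf A by apply: lt_le_trans e0 _; exact: lb_le_inf iA.1 lbA.
have DP y : P y -> inf A <= mdist x y.
  by move=> Py; apply: ge_inf; [exact: iA.2|exists y].
have [_ [q Pq <-] qD] := inf_adherent D0 iA.
have [||r [r1 r2 cr]] := @clopen_ball R X P x (inf A / 4) (inf A / 2) cP.
- by move=> y xy /DP; lra.
- lra.
exists (r, q) => /=; split=> //; [lra| |lra].
by move=> y xy /DP; lra.
Qed.

(** The complement of [P] is cut into countably many clopen pieces, each of
    which is sent to a point of [P] no further away than a fixed multiple of the
    distance to [P]. *)
Lemma exists_retraction (R : realType) (X : metricType R) (P : set X) :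
  closed P -> countable (~` P) -> P !=set0 -> exists rho, retraction P rho.
Proof.
move=> clP cP P0.
have [[x0 nPx0]|/forallNP Pall] := pselect (exists x, ~ P x); last first.
  by exists id; split=> // x; [exact: cvg_id|apply: contrapT; exact: Pall].
have [z [zP zsurj]] := @countable_enumeration X (~` P) x0 nPx0 cP.
have /choice[rq rqP] := fun n => clopen_ball_near clP cP P0 (zP n).
pose r n := (rq n).1; pose q n := (rq n).2.
have /choice[rho rhoE] : forall x, exists y, (P x -> y = x) /\
    (~ P x -> exists n, [/\ mdist (z n) x < r n,
       forall k, (k < n)%N -> ~ (mdist (z k) x < r k) & y = q n]).
  move=> x; have [Px|nPx] := pselect (P x); first by exists x.
  have [n0 zn0] := zsurj x nPx.
  have ex : exists n, mdist (z n) x < r n.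
    by exists n0; rewrite zn0 mdistxx; have [] := rqP n0.
  exists (q (ex_minn ex)); split=> // _; exists (ex_minn ex).
  case: ex_minnP => n xn nmin; split=> // k kn xk.
  by have := nmin k xk; rewrite leqNgt kn.
have rhoP x : P x -> rho x = x by have [] := rhoE x.
exists rho; split=> //; last first.
  move=> x; have [Px|nPx] := pselect (P x); first by rewrite rhoP.
  by have [n [_ _ ->]] := (rhoE x).2 nPx; have [] := rqP n.
(* Continuity: distances grow by a factor at most 10 at points of P, and rho is
   locally constant elsewhere. *)
move=> x; have [Px|nPx] := pselect (P x).
  apply/metricType_numDomainType.cvgrPdist_lt => e e0; apply/nbhs_mdist.
  exists (e / 10); first lra.
  move=> y xy; rewrite (rhoP x)//.
  have [Py|nPy] := pselect (P y); first by rewrite rhoP//; lra.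
  have [n [yn _ ->]] := (rhoE y).2 nPy.
  have [_ _ nP _ qn] := rqP n; rewrite -/(r n) -/(q n) in nP qn.
  have rn : 2 * r n <= mdist (z n) x by rewrite leNgt; apply/negP => /nP.
  have h1 := metric_triangle (z n) y x.
  have h2 := metric_triangle x y (z n).
  have h3 := metric_triangle x (z n) (q n).
  by rewrite (metric_sym y x) in h1; rewrite (metric_sym y (z n)) in h2; lra.
have [n [xn nx rx]] := (rhoE x).2 nPx.
have N1 : nbhs x [set y | mdist (z n) y < r n].
  by have [_ [oB _] _ _ _] := rqP n; exact: open_nbhs_nbhs.
have N2 : nbhs x [set y | forall k, (k < n)%N -> ~ (mdist (z k) y < r k)].
  apply: nbhs_forall_lt => k kn; apply: open_nbhs_nbhs; split; last exact: nx.
  by have [_ [_ cB] _ _ _] := rqP k; rewrite openC.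
apply: (@cvg_trans _ ((fun=> rho x) @ x)); last exact: cvg_cst.
apply: near_eq_cvg.
apply: filterS (filterI N1 N2) => y [yn ny].
have nPy : ~ P y.
  have [r0 _ nP _ _] := rqP n; rewrite -/(r n) in r0 nP.
  by apply: nP; rewrite /= in yn; lra.
have [m [ym my ->]] := (rhoE y).2 nPy; rewrite rx.
have [mn|nm|->//] := ltngtP m n.
  by case: (ny m mn).
by case: (my n nm).
Qed.

(** Countably many clopen sets form a base at the points outside [P]. *)
Lemma clopen_base_off (R : realType) (X : metricType R) (P : set X) :
  closed P -> countable (~` P) ->
  exists N : nat -> set X, (forall k, clopen (N k) /\ N k `<=` ~` P) /\
    forall x (e : R), ~ P x -> 0 < e ->
      exists2 k, N k x & forall y, N k y -> mdist x y < e.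
Proof.
move=> clP cP.
have [[x0 nPx0]|/forallNP Pall] := pselect (exists x, ~ P x); last first.
  exists (fun=> set0); split=> [_|x e nPx]; last by case: (Pall x).
  by split=> //; split; [exact: open0|exact: closed0].
have [z [zP zsurj]] := @countable_enumeration X (~` P) x0 nPx0 cP.
have /choice[N NP] : forall m : nat * nat, exists C : set X,
    [/\ clopen C, C `<=` ~` P, C (z m.1) &
        forall y, C y -> mdist (z m.1) y < m.2.+1%:R^-1].
  move=> [i j] /=; have [e e0 eP] := closed_ball_avoid clP (zP i).
  have j0 : 0 < j.+1%:R^-1 :> R by rewrite invr_gt0.
  have [||r [r0 re cr]] := @clopen_ball R X P (z i) 0 (Num.min e j.+1%:R^-1) cP.
  - by move=> y; rewrite lt_min => /andP[/eP].
  - by rewrite lt_min e0.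
  move: re; rewrite lt_min => /andP[re rj].
  exists [set y | mdist (z i) y < r]; split=> //=.
  - by move=> y /= yr; apply: eP; exact: lt_trans yr re.
  - by rewrite mdistxx.
  - by move=> y yr; exact: lt_trans yr rj.
exists (fun m => N (odflt (0, 0)%N (choice.unpickle m))); split=> [k|x e nPx e0].
  by have [] := NP (odflt (0, 0)%N (choice.unpickle k)).
have [i zi] := zsurj x nPx.
exists (choice.pickle (i, Num.truncn e^-1)); rewrite choice.pickleK /=.
  by have [_ _ + _] := NP (i, Num.truncn e^-1); rewrite /= zi.
have [_ _ _ small] := NP (i, Num.truncn e^-1).
move=> y /small; rewrite /= zi => /lt_le_trans; apply.
by rewrite invf_ple ?posrE// ltW// truncnS_gt.
Qed.

(** Countably many clopen sets missing [P], outside of which points are close to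
    their image under the retraction. *)
Lemma clopen_far (R : realType) (X : metricType R) (P : set X) (rho : X -> X) :
  retraction P rho -> countable (~` P) ->
  exists F : nat -> set X, (forall k, clopen (F k) /\ F k `<=` ~` P) /\
    forall e : R, 0 < e -> exists k, forall y, ~ F k y -> mdist y (rho y) < e.
Proof.
move=> [crho _ rhoP] cP.
have cw : continuous (fun y => mdist y (rho y)).
  move=> y; apply/cvgrPdist_lt => e e0.
  have e20 : 0 < e / 2 by lra.
  have N1 : nbhs y [set t | mdist (rho y) (rho t) < e / 2].
    apply: (crho y [set t | mdist (rho y) t < e / 2]).
    by apply/nbhs_mdist; exists (e / 2).
  have N2 : nbhs y [set t | mdist y t < e / 2].
    by apply/nbhs_mdist; exists (e / 2).
  apply: filterS (filterI N1 N2) => t [/= t1 t2].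
  have h1 := metric_triangle y t (rho y).
  have h2 := metric_triangle t (rho t) (rho y).
  have h3 := metric_triangle t y (rho t).
  have h4 := metric_triangle y (rho y) (rho t).
  rewrite (metric_sym (rho t) (rho y)) in h2.
  rewrite (metric_sym t y) in h3.
  by rewrite ltr_norml; apply/andP; split; lra.
have /choice[F FP] : forall k : nat, exists C : set X,
    (clopen C /\ C `<=` ~` P) /\ forall y, ~ C y -> mdist y (rho y) < k.+1%:R^-1.
  move=> k; have k0 : 0 < k.+1%:R^-1 :> R by rewrite invr_gt0.
  have [r [r0 rk nr]] := avoid_countable k0
    (sub_countable (card_image_le (fun y => mdist y (rho y)) (~` P)) cP).
  exists [set y | r < mdist y (rho y)]; split; [split; [split|]|].
  - by move/continuousP: cw => /(_ _ (@open_gt R r)).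
  - rewrite -openC (_ : ~` _ = [set y | mdist y (rho y) < r]).
      by move/continuousP: cw => /(_ _ (@open_lt R r)).
    apply/seteqP; split=> y /=; last first.
      by move=> ry yr; have := lt_trans ry yr; rewrite ltxx.
    move/negP; rewrite -leNgt le_eqVlt => /predU1P[ry|//].
    exfalso; apply: nr; exists y => // Py.
    by move: ry; rewrite rhoP// mdistxx => ry; rewrite ry ltxx in r0.
  - by move=> y /= + Py; rewrite rhoP// mdistxx => /(lt_trans r0); rewrite ltxx.
  - by move=> y /negP; rewrite -leNgt => /le_lt_trans; apply.
exists F; split=> [k|e e0]; first by have [] := FP k.
exists (Num.truncn e^-1) => y /(FP _).2 /lt_le_trans; apply.
by rewrite invf_ple ?posrE// ltW// truncnS_gt.
Qed.

(** * The trace on the perfect part *)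

Section function_families.
Context {R : realType} {X : metricType R}.
Variables (P : set X) (u : nat -> X -> R) (z : nat -> X) (s : nat -> R).
Hypothesis cu : forall n, continuous (u n).
Hypothesis uP : forall n y, u n y = 0 -> P y.
Hypothesis deu : forall n, cells_dense P u n.
Hypothesis neu : forall n, cells_nonempty P u n.
Hypothesis sep : forall n, separates P u n (u n) (z n) (s n).
Hypothesis base : forall p (e : R), 0 < e ->
  exists2 m, mdist (z m) p < s m & 3 * s m < e.

(** A zero of one of the functions is a limit of points of [P] of either sign,
    so that the trace on [P] of a pair still consists of mutual exteriors. *)
Lemma closure_side m i p : u m p = 0 ->
  closure (P `&` [set q | side i (u m q)]) p.
Proof.
move=> ump.
have : closure (P `&` cell u m.+1 (fun k => if k == m then i else 0 < u k p)) p.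
  apply: deu; first exact: uP ump.
  move=> k _; have [->|up0] := eqVneq (u k p) 0; [by left|right].
  have [km|_] := eqVneq k m; last exact: side_neq.
  by rewrite km ump eqxx in up0.
apply: closureS => q [Pq uq]; split=> //.
by have := uq m (ltnSn m); rewrite eqxx.
Qed.

(** The pairs form a subbase on [P]. *)
Lemma side_base p (e : R) : P p -> 0 < e ->
  exists F : seq (nat * bool), (forall f, f \in F -> side f.2 (u f.1 p)) /\
    forall q, P q -> (forall f, f \in F -> side f.2 (u f.1 q)) ->
      mdist p q < e.
Proof.
move=> Pp e0; have [n np ne] := base p e0.
exists [seq (k, 0 < u k p) | k <- iota 0 n.+1 & u k p != 0]; split.
  by move=> _ /mapP[k + ->]; rewrite mem_filter => /andP[up0 _]; exact: side_neq.
move=> q Pq Fq.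
have pq k i : (k <= n)%N -> side i (u k p) -> side i (u k q).
  move=> kn sp; have up0 : u k p != 0.
    by apply/eqP => up; move: sp; rewrite up /side; case: i; rewrite ltxx.
  have /Fq /= : (k, 0 < u k p) \in
      [seq (k, 0 < u k p) | k <- iota 0 n.+1 & u k p != 0].
    by apply: map_f; rewrite mem_filter up0 mem_iota.
  by case: i sp => /= sp; [rewrite sp|rewrite ltNge (ltW sp)].
have : mdist (z n) q < 2 * s n.
  apply: (sep _ Pq np) => //; last exact: (pq n false).
  by move=> k kn i; apply: pq; exact: ltnW.
have := metric_triangle p (z n) q; rewrite (metric_sym p (z n)); lra.
Qed.

Lemma trace_independent (S : nat -> bool -> set X) :
  (forall m i, S m i = [set x | side i (u m x)]) ->
  independent_subbase (subbase_trace P S).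
Proof.
move=> SE; split; last first.
  move=> sigma /finite_set_nat_bounded[N sN].
  have [q [Pq uq]] := neu N (fun k => odflt false (sigma k)).
  exists (exist _ q (mem_set Pq)) => -[n i] /= sn.
  rewrite /subbase_trace SE /preimage/= set_valE /=.
  have nN : (n < N)%N by apply: sN; rewrite /tdom /= sn.
  by have := uq n nN; rewrite sn.
apply: dyadic_subbase_local => [n i|n y|n i y|y U].
- rewrite /subbase_trace SE.
  have /continuousP cval := @initial_continuous P X set_val.
  exact: cval (open_side i (@cu n)).
- by rewrite /subbase_trace !SE; exact: side_disjoint.
- rewrite /subbase_trace !SE => n0 n1 B [? [[V oV <-] Vy VB]].
  have clp := closure_side i (side_eq0 n0 n1).
  have /clp[q [[Pq sq] Vq]] : nbhs (set_val y) V by exact: open_nbhs_nbhs.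
  by exists (exist _ q (mem_set Pq)); split => //; apply: VB; exact: Vq.
- move=> [? [[V oV <-] Vy VB]].
  have /nbhs_mdist[e e0 eV] : nbhs (set_val y) V by exact: open_nbhs_nbhs.
  have [F [Fy FV]] := side_base (set_valP y) e0.
  exists F; split=> [f fF|q Fq].
    by rewrite /subbase_trace SE; exact: Fy.
  apply: VB; apply: eV; apply: FV; first exact: (set_valP q).
  by move=> f fF; have := Fq f fF; rewrite /subbase_trace SE.
Qed.

End function_families.

(** * Assembling the subbase *)

(** A clopen set and its complement, as the pair of a dyadic subbase. *)
Definition clopen_pair (X : topologicalType) (B : set X) (i : bool) : set X :=
  if i then ~` B else B.

Lemma open_clopen_pair (X : topologicalType) (B : set X) i :
  clopen B -> open (clopen_pair B i).
Proof. by case=> oB cB; case: i => //=; rewrite openC. Qed.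

(** A countable space has a proper dyadic subbase of clopen sets; this settles
    the case of an empty perfect part. *)
Lemma subbase_countable (R : realType) (X : metricType R) :
  countable [set: X] ->
  exists S : nat -> bool -> set X,
    [/\ dyadic_subbase S, proper_dyadic S &
        forall n i, half_clopen set0 (S n i)].
Proof.
rewrite -setC0 => cX; have [N [clN baseN]] := clopen_base_off closed0 cX.
pose S n := clopen_pair (N n).
have oS n i : open (S n i) by exact/open_clopen_pair/(clN n).1.
have dS n y : S n false y -> ~ S n true y by move=> ? /(_ _).
have bS n y : ~ S n false y -> ~ S n true y ->
    set0 y /\ forall i, closure (S n i) y by move=> n0 /(_ n0).
exists S; split.
- apply: dyadic_subbase_local => // y U.
  move=> /nbhs_mdist[e e0 eU]; have [k Nky small] := baseN y e id e0.
  exists [:: (k, false)]; split=> [p|x Sx]; first by rewrite inE => /eqP ->.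
  by apply/eU/small/(Sx (k, false)); rewrite inE.
- by apply: (proper_dyadic_off_boundary oS dS bS).
- exact: half_clopen_local oS dS bS.
Qed.

Section assembly.
Context {R : realType} {X : metricType R}.
Variables (P : set X) (rho : X -> X) (u : nat -> X -> R).
Variables (z : nat -> X) (s : nat -> R) (B : nat -> set X).
Hypothesis cu : forall n, continuous (u n).
Hypothesis urho : forall n y, u n (rho y) = u n y.
Hypothesis uP : forall n y, u n y = 0 -> P y.
Hypothesis deu : forall n, cells_dense P u n.
Hypothesis neu : forall n, cells_nonempty P u n.
Hypothesis sep : forall n, separates P u n (u n) (z n) (s n).
Hypothesis base : forall p (e : R), 0 < e ->
  exists2 m, mdist (z m) p < s m & 3 * s m < e.
Hypothesis Prho : forall y, P (rho y).
Hypothesis clB : forall k, clopen (B k).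
Hypothesis BP : forall k, B k `<=` ~` P.
Hypothesis near : forall x (e : R), ~ P x -> 0 < e ->
  exists2 k, B k x & forall y, B k y -> mdist x y < e.
Hypothesis far : forall e : R, 0 < e ->
  exists k, forall y, ~ B k y -> mdist y (rho y) < e.
Variable g : nat -> nat + nat.
Hypothesis ginj : injective g.
Hypothesis gB : forall n k, g n = inr k -> B k !=set0.
Hypothesis gl : forall m, exists n, g n = inl m.
Hypothesis gr : forall k, B k !=set0 -> exists n, g n = inr k.

(** The pair of index [n] comes either from a function or from a nonempty
    clopen set missing [P], as told by the enumeration [g]. *)
Let S n i : set X :=
  match g n with
  | inl m => [set x | side i (u m x)]
  | inr k => clopen_pair (B k) i
  end.

Let open_S n i : open (S n i).
Proof.
by rewrite /S; case: (g n) => m; [exact: open_side|exact: open_clopen_pair].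
Qed.

Let disjoint_S n y : S n false y -> ~ S n true y.
Proof.
by rewrite /S; case: (g n) => m; [exact: side_disjoint|move=> ? /(_ _)].
Qed.

Let boundary_S n y : ~ S n false y -> ~ S n true y ->
  P y /\ forall i, closure (S n i) y.
Proof.
rewrite /S; case: (g n) => m; last by move=> n0 /(_ n0).
move=> n0 n1; have um := side_eq0 n0 n1; split; first exact: uP um.
move=> i; apply: closureS (closure_side uP deu i um) => q []; by [].
Qed.

Let S_subbase : dyadic_subbase S.
Proof.
apply: dyadic_subbase_local => // [n i y n0 n1|y U /nbhs_mdist[e e0 eU]].
  by have [_] := boundary_S n0 n1.
have [Py|nPy] := pselect (P y); last first.
  have [k Bky small] := near nPy e0.
  have [n gn] : exists n, g n = inr k by apply: gr; exists y.
  exists [:: (n, false)]; split=> [p|x Sx].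
    by rewrite inE => /eqP ->; rewrite /S gn.
  by have := Sx (n, false); rewrite inE eqxx /S gn => /(_ isT) /small /eU.
(* The functions do not distinguish x from rho x: they bring rho x close to y,
   and a clopen set with its complement brings x close to rho x. *)
have e20 : 0 < e / 2 by lra.
have [F [Fy small]] := side_base sep base Py e20.
have [k Bk] := far e20.
have /choice[h hE] := gl.
have [G [Gy GB]] : exists G : seq (nat * bool),
    (forall p, p \in G -> S p.1 p.2 y) /\
    forall x, (forall p, p \in G -> S p.1 p.2 x) -> ~ B k x.
  have [Bk0|nBk] := pselect (B k !=set0); last first.
    by exists [::]; split=> // x _ Bx; apply: nBk; exists x.
  have [n gn] := gr Bk0.
  exists [:: (n, true)]; split=> [p|x Sx].
    by rewrite inE => /eqP ->; rewrite /S gn /= => /BP.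
  by have := Sx (n, true); rewrite inE eqxx /S gn => /(_ isT).
exists ([seq (h f.1, f.2) | f <- F] ++ G); split=> [p|x Sx].
  rewrite mem_cat => /orP[/mapP[f fF ->]|]; last exact: Gy.
  by rewrite /S hE /=; exact: Fy.
apply: eU.
have xrho : mdist x (rho x) < e / 2.
  by apply/Bk/GB => p pG; apply: Sx; rewrite mem_cat pG orbT.
have yrho : mdist y (rho x) < e / 2.
  apply: small => // f fF; rewrite urho.
  have := Sx (h f.1, f.2); rewrite mem_cat /S hE; apply.
  by apply/orP; left; apply/mapP; exists f.
have := metric_triangle y (rho x) x; rewrite (metric_sym (rho x) x); lra.
Qed.

Let S_proper : proper_dyadic S.
Proof.
apply: (proper_dyadic_off_boundary open_S disjoint_S boundary_S).
move=> sigma p fs Pp np.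
have [N sN] := finite_set_nat_bounded fs.
have /choice[h hE] := gl.
have hinj : injective h by move=> m m' hm; have := hE m; rewrite hm hE => -[].
have [M sM] : exists M, forall m, tdom sigma (h m) -> (m < M)%N.
  by apply: finite_set_nat_bounded; apply: finite_preimage fs => m m' _ _ /hinj.
(* Where sigma gives no sign, any sign compatible with p will do. *)
pose b m := if sigma (h m) is Some i then i else 0 < u m p.
have clp : closure (P `&` cell u M b) p.
  apply: deu => // m _; have [->|up0] := eqVneq (u m p) 0; [by left|right].
  rewrite /b; case E : (sigma (h m)) => [i|]; last exact: side_neq.
  have := np _ _ E; rewrite /S hE /= /side.
  case: i {E} => /= /negP; rewrite -leNgt => up; rewrite lt_neqAle up andbT //.
  by rewrite eq_sym.
move=> V Vp.
(* Near p, all points lie in the clopen members selected by sigma. *)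
have Wp : nbhs p [set y | forall n, (n < N)%N -> forall k i,
    g n = inr k -> sigma n = Some i -> S n i y].
  apply: nbhs_forall_lt => n _.
  have [[k [i [gn sn]]]|none] :=
    pselect (exists k i, g n = inr k /\ sigma n = Some i); last first.
    apply: filterS (@filterT _ _ _) => y _ k i gn sn.
    by exfalso; apply: none; exists k, i.
  apply: (@filterS _ _ _ (S n i)).
    by move=> y Sy k' i' _; rewrite sn => -[<-].
  apply: open_nbhs_nbhs; split => //.
  have := np _ _ sn; rewrite /S gn; case: (i) => //=; last exact: contrapT.
have [q [[Pq bq] [Vq Wq]]] := clp _ (filterI Vp Wp).
exists q; split=> // -[n i] /= sn.
have nN : (n < N)%N by apply: sN; rewrite /tdom /= sn.
case gn: (g n) => [m|k]; last exact: Wq gn sn.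
have hm : h m = n by apply: ginj; rewrite hE gn.
have mM : (m < M)%N by apply: sM; rewrite /tdom /= hm sn.
by have := bq m mM; rewrite /b hm sn /S gn.
Qed.

Let S_trace : exists e : nat -> nat,
  [/\ injective e, range e = trace_index P S &
      independent_subbase (subbase_trace P (S \o e))].
Proof.
have /choice[h hE] := gl.
exists h; split.
- by move=> m m' hm; have := hE m; rewrite hm hE => -[].
- apply/seteqP; split=> [_ [m _ <-] [i [_ nP]]|n nn].
    have [q [Pq uq]] := neu m.+1 (fun=> i).
    by apply: (nP q) => //; rewrite /S hE; exact: (uq m).
  case gn: (g n) => [m|k]; first by exists m => //; apply: ginj; rewrite hE gn.
  exfalso; apply: nn; exists false.
  by rewrite /S gn; split; [exact: gB gn|exact: BP].
- apply: (trace_independent cu uP deu neu sep base) => m i.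
  by rewrite /= /S hE.
Qed.

Lemma assembled_subbase : exists S : nat -> bool -> set X,
  [/\ dyadic_subbase S, proper_dyadic S,
      forall n i, half_clopen P (S n i) &
      exists e : nat -> nat,
        [/\ injective e, range e = trace_index P S &
            independent_subbase (subbase_trace P (S \o e))]].
Proof.
exists S; split=> //; exact: half_clopen_local open_S disjoint_S boundary_S.
Qed.

End assembly.

Unset Implicit Arguments.

Theorem theorem1 (R : realType) (X : metricType R) (Xs : set X) :
  separable_space X ->
  cantor_bendixson_set Xs ->
  exists S : nat -> bool -> set X,
    [/\ dyadic_subbase S, proper_dyadic S,
        forall n i, half_clopen Xs (S n i) &
        Xs !=set0 ->
        exists e : nat -> nat,
          [/\ injective e, range e = trace_index Xs S &
              independent_subbase (subbase_trace Xs (S \o e))]].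
Proof.
move=> sX [clP iP cP].
have [[p0 Pp0]|P0] := pselect (Xs !=set0); last first.
  have PE : Xs = set0 by apply/seteqP; split=> // x Px; apply: P0; exists x.
  subst Xs; rewrite setC0 in cP.
  have [S [dS pS hS]] := subbase_countable cP.
  by exists S; split=> // -[].
have Pne : Xs !=set0 by exists p0.
have dP := isolated0_dense_in_itself iP.
have [rho rhoP] := exists_retraction clP cP Pne.
have [z [s [s0 base]]] := ball_sequence p0 sX.
have [u [uE neu deu sep]] := function_sequence rhoP cP dP Pne s0 base.
have [N [clN near]] := clopen_base_off clP cP.
have [F [clF far]] := clopen_far rhoP cP.
pose B k := if odd k then F k./2 else N k./2.
pose G : set (nat + nat) :=
  [set t | match t with inl _ => True | inr k => B k !=set0 end].
have iG : infinite_set G.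
  move=> fG; apply: infinite_nat.
  rewrite (_ : setT = inl @^-1` G); last by apply/seteqP; split.
  by apply: finite_preimage fG => ? ? _ _ [].
have [g [ginj gG gsurj]] := infinite_enumeration iG.
have cu n : continuous (u n) by have [] := uE n.
have urho n y : u n (rho y) = u n y by have [] := uE n.
have uP n y : u n y = 0 -> Xs y by have [_ _] := uE n; exact.
have BE k : clopen (B k) /\ B k `<=` ~` Xs.
  by rewrite /B; case: (odd k); [exact: clF|exact: clN].
have nearB x (e : R) : ~ Xs x -> (0 < e) ->
    exists2 k, B k x & forall y, B k y -> (mdist x y < e).
  move=> nPx e0; have [k Nx small] := near x e nPx e0.
  by exists k.*2; rewrite /B odd_double doubleK.
have farB (e : R) : (0 < e) ->
    exists k, forall y, ~ B k y -> (mdist y (rho y) < e).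
  move=> e0; have [k Fk] := far e e0.
  by exists k.*2.+1; rewrite /B /= odd_double /= uphalf_double.
have gB n k : g n = inr k -> B k !=set0 by move=> gn; have := gG n; rewrite gn.
have [_ Prho _] := rhoP.
have [S [dS pS hS tS]] := assembled_subbase cu urho uP deu neu sep base Prho
  (fun k => (BE k).1) (fun k => (BE k).2) nearB farB ginj gB
  (fun m => gsurj (inl m) I) (fun k Bk => gsurj (inr k) Bk).
by exists S.
Qed.
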